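(* Up to isomorphism of graphs, $\mathcal{H}=\bigcup_{k\in\mathbb{N}}\mathcal{H}_k$, where $\mathcal{H}$ is the class of connected good graphs, $\mathcal{H}_1=\{K_1\}\cup\{K_{r,s}\mid r,s\in\mathbb{N}\}$, and for every integer $k\ge 2$, $$\mathcal{H}_k=\{K+H\mid K,H\in\mathcal{H}_{k-1}\}\cup\{G+\overline{K_\ell}\mid G\in\mathcal{H}_{k-1},\ \ell\in\mathbb{N}\}.$$
   Context: Graphs are finite, simple and undirected, with nonempty vertex set $V(G)$ and edge set $E(G)$; $\mathbb{N}$ is the set of positive integers. $N_G[u]$ denotes the closed neighbourhood of $u$ in $G$. An edge $e=uv\in E(G)$ is a good edge if $N_G[u]\cup N_G[v]=V(G)$. A graph $G$ is a good graph if every edge of $G$ is a good edge. $\mathcal{H}$ is the class of all good graphs that are connected. $K_1$ is the one-vertex graph, $K_{r,s}$ is the complete bipartite graph with partite sets of sizes $r$ and $s$, and $\overline{K_\ell}$ is the edgeless graph on $\ell$ vertices. The join $G+H$ of two (vertex-disjoint copies of) graphs $G$ and $H$ is the graph with vertex set $V(G)\cup V(H)$ and edge set $E(G)\cup E(H)\cup\{uv: u\in V(G), v\in V(H)\}$. *)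

(* Defs.v *)
From mathcomp Require Import all_boot.

Set Implicit Arguments.
Unset Strict Implicit.
Unset Printing Implicit Defensive.

Record sgraph := SGraph {
  vertex :> finType;
  adj : rel vertex;
  adj_sym : symmetric adj;
  adj_irrefl : irreflexive adj;
  vertex_gt0 : 0 < #|vertex|
}.

Definition closed_nbhd (G : sgraph) (u : G) : {set G} :=
  [set v | (v == u) || adj u v].

Definition good_edge (G : sgraph) (u v : G) : Prop :=
  adj u v /\ closed_nbhd u :|: closed_nbhd v = [set: G].

Definition good_graph (G : sgraph) : Prop :=
  forall u v : G, adj u v -> good_edge u v.

Definition connected_graph (G : sgraph) : Prop :=
  forall u v : G, connect (@adj G) u v.

Definition graph_iso (G H : sgraph) : Prop :=
  exists2 f : G -> H, bijective f & forall u v : G, adj (f u) (f v) = adj u v.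

(** Only nonempty graphs are considered, so the edgeless and complete bipartite
    graphs take proofs that their size parameters are positive. *)

Section Edgeless.
Variables (n : nat) (n_gt0 : 0 < n).

Definition edgeless_adj : rel 'I_n := fun _ _ => false.

Fact edgeless_sym : symmetric edgeless_adj. Proof. by []. Qed.
Fact edgeless_irrefl : irreflexive edgeless_adj. Proof. by []. Qed.
Fact edgeless_gt0 : 0 < #|'I_n|. Proof. by rewrite card_ord. Qed.

Definition edgeless : sgraph :=
  SGraph edgeless_sym edgeless_irrefl edgeless_gt0.
End Edgeless.

Definition K1 : sgraph := edgeless (ltn0Sn 0).

Section CompleteBipartite.
Variables r s : nat.

Definition bipartite_adj : rel ('I_r + 'I_s)%type := fun x y =>
  match x, y with
  | inl _, inr _ | inr _, inl _ => true
  | _, _ => false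
  end.

Fact bipartite_sym : symmetric bipartite_adj. Proof. by case=> ? []. Qed.
Fact bipartite_irrefl : irreflexive bipartite_adj. Proof. by case. Qed.
Fact bipartite_gt0 : 0 < r -> 0 < s -> 0 < #|{: 'I_r + 'I_s}|.
Proof. by rewrite card_sum !card_ord addn_gt0 => ->. Qed.

Definition complete_bipartite (r_gt0 : 0 < r) (s_gt0 : 0 < s) : sgraph :=
  SGraph bipartite_sym bipartite_irrefl (bipartite_gt0 r_gt0 s_gt0).
End CompleteBipartite.

Section Join.
Variables G H : sgraph.

Definition join_adj : rel (G + H)%type := fun x y =>
  match x, y with
  | inl u, inl v => adj u v
  | inr u, inr v => adj u v
  | _, _ => true
  end.

Fact join_sym : symmetric join_adj.
Proof. by case=> u [] v //=; apply: adj_sym. Qed.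
Fact join_irrefl : irreflexive join_adj.
Proof. by case=> u /=; apply: adj_irrefl. Qed.
Fact join_gt0 : 0 < #|{: G + H}|.
Proof. by rewrite card_sum addn_gt0 vertex_gt0. Qed.

Definition graph_join : sgraph := SGraph join_sym join_irrefl join_gt0.
End Join.

Definition classH (G : sgraph) : Prop := connected_graph G /\ good_graph G.

(** [classHk k] is the isomorphism closure of the class H_k, for k >= 1; the
    index 0 is not used and is given the empty class. *)
Fixpoint classHk (k : nat) (G : sgraph) : Prop :=
  match k with
  | 0 => False
  | 1 => graph_iso G K1 \/
         exists (r s : nat) (r_gt0 : 0 < r) (s_gt0 : 0 < s),
           graph_iso G (complete_bipartite r_gt0 s_gt0)
  | k'.+1 =>
         (exists K H : sgraph,
            [/\ classHk k' K, classHk k' H & graph_iso G (graph_join K H)]) \/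
         (exists (K : sgraph) (l : nat) (l_gt0 : 0 < l),
            classHk k' K /\ graph_iso G (graph_join K (edgeless l_gt0)))
  end.

(* Main.v *)
(** An edge [uv] is good iff no vertex outside it misses both ends, so a graph
    is good iff non-adjacency is transitive, i.e. iff it is complete
    multipartite.  The classes H_k peel off the parts of such a graph one at a
    time: the neighbourhood of a non-isolated vertex [x] and the part of [x] are
    completely joined, and the neighbourhood is again good. *)

Require Import Defs.
From mathcomp Require Import all_boot.

Set Implicit Arguments.
Unset Strict Implicit.
Unset Printing Implicit Defensive.

Lemma graph_iso_sym (G H : sgraph) : graph_iso G H -> graph_iso H G.
Proof.
case=> f [g fK gK] f_adj; exists g; first by exists f.
by move=> u v; rewrite -f_adj !gK.
Qed.

Lemma graph_iso_trans (G H K : sgraph) :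
  graph_iso G H -> graph_iso H K -> graph_iso G K.
Proof.
case=> f f_bij f_adj [g g_bij g_adj]; exists (g \o f); first exact: bij_comp.
by move=> u v /=; rewrite g_adj f_adj.
Qed.

Lemma graph_iso_join (G G' H H' : sgraph) :
  graph_iso G G' -> graph_iso H H' ->
  graph_iso (graph_join G H) (graph_join G' H').
Proof.
case=> f [f' fK f'K] f_adj [g [g' gK g'K] g_adj].
exists (fun w => match w with inl u => inl (f u) | inr v => inr (g v) end).
  exists (fun w => match w with inl u => inl (f' u) | inr v => inr (g' v) end).
    by case=> w; rewrite ?fK ?gK.
  by case=> w; rewrite ?f'K ?g'K.
by case=> u [] v /=.
Qed.

Lemma graph_iso_refl (G : sgraph) : graph_iso G G.
Proof. by exists id => //; exists id. Qed.

Lemma independent_iso_edgeless (G : sgraph) :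
  (forall u v : G, ~~ adj u v) -> graph_iso G (edgeless (vertex_gt0 G)).
Proof.
move=> indep; exists enum_rank; first exact: enum_rank_bij.
by move=> u v; rewrite (negPf (indep u v)).
Qed.

(** Brings the bipartite members of the base class under the lemmas on joins; the identity serves
    because both graphs live on ['I_r + 'I_s]. *)
Lemma complete_bipartite_iso_join (r s : nat) (r_gt0 : 0 < r) (s_gt0 : 0 < s) :
  graph_iso (complete_bipartite r_gt0 s_gt0)
            (graph_join (edgeless r_gt0) (edgeless s_gt0)).
Proof. by exists id; [exists id | case=> u [] v]. Qed.

(** Open neighbourhoods may replace closed ones: [u] and [v] themselves are covered, being adjacent
    to each other. *)
Lemma good_graphP (G : sgraph) :
  good_graph G <-> forall u v w : G, adj u v -> adj u w || adj v w.
Proof.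
split=> [good u v w uv | trans u v uv].
  have [_ /setP/(_ w)] := good u v uv.
  rewrite !inE => /orP[] /orP[/eqP->|->] //; last by rewrite orbT.
    by rewrite adj_sym uv orbT.
  by rewrite uv.
split=> //; apply/setP=> w; rewrite !inE.
by case/orP: (trans u v w uv) => ->; rewrite !orbT.
Qed.

Lemma good_graph_iso (G H : sgraph) :
  graph_iso G H -> good_graph H -> good_graph G.
Proof.
case=> f _ f_adj /good_graphP good; apply/good_graphP=> u v w.
by rewrite -!f_adj; apply: good.
Qed.

Lemma good_graph_join (G H : sgraph) :
  good_graph G -> good_graph H -> good_graph (graph_join G H).
Proof.
move=> /good_graphP goodG /good_graphP goodH; apply/good_graphP.
by case=> u [] v [] w //=; rewrite ?orbT //; [apply: goodG | apply: goodH].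
Qed.

Lemma good_edgeless (n : nat) (n_gt0 : 0 < n) : good_graph (edgeless n_gt0).
Proof. by []. Qed.

Lemma connected_graph_iso (G H : sgraph) :
  graph_iso G H -> connected_graph H -> connected_graph G.
Proof.
case=> f [g fK gK] f_adj conn u v.
have [p] := connectP (conn (f u) (f v)).
(* Induction on a path from [f u] to [f v], whose vertices are pulled back along the inverse [g]. *)
elim: p u => [u _ /(can_inj fK)-> | w p IHp u /= /andP[uw wp] last_p].
  exact: connect0.
apply: connect_trans (connect1 _) (IHp (g w) _ _); rewrite ?gK //.
by rewrite -f_adj gK.
Qed.

(** Vertices on opposite sides are adjacent; two on the same side are linked through a vertex of the
    other side, which is nonempty. *)
Lemma connected_graph_join (G H : sgraph) : connected_graph (graph_join G H).
Proof.
have [/card_gt0P[x _] /card_gt0P[y _]] := (vertex_gt0 G, vertex_gt0 H).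
have cross (u : G) (v : H) : connect (@adj (graph_join G H)) (inl u) (inr v).
  exact: connect1.
have cross' (u : G) (v : H) : connect (@adj (graph_join G H)) (inr v) (inl u).
  exact: connect1.
case=> u [] v //; first exact: connect_trans (cross u y) (cross' v y).
exact: connect_trans (cross' x u) (cross x v).
Qed.

(** The factors are asked to be good and the join itself supplies connectivity, so edgeless factors
    are covered too. *)
Lemma classH_join (G K H : sgraph) :
  good_graph K -> good_graph H -> graph_iso G (graph_join K H) -> classH G.
Proof.
move=> goodK goodH iso; split.
  exact: connected_graph_iso iso (@connected_graph_join K H).
exact: good_graph_iso iso (good_graph_join goodK goodH).
Qed.

Lemma classHk_classH (k : nat) (G : sgraph) : classHk k G -> classH G.
Proof.
elim: k G => [|[|k] IHk] G //; last first.
  case=> [[K [H [/IHk[_ goodK] /IHk[_ goodH]]]] | [K [l [l_gt0 [/IHk[_ goodK]]]]]].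
    exact: classH_join.
  exact/classH_join/good_edgeless.
case=> [iso | [r [s [r_gt0 [s_gt0 iso]]]]]; last first.
  have := graph_iso_trans iso (complete_bipartite_iso_join r_gt0 s_gt0).
  by apply: classH_join; apply: good_edgeless.
split; last exact: good_graph_iso iso (@good_edgeless _ _).
apply: connected_graph_iso iso _ => u v.
by rewrite (ord1 u) (ord1 v) connect0.
Qed.

Section Induced.
Variables (G : sgraph) (A : {set G}) (A_gt0 : 0 < #|A|).

Definition induced_adj : rel {x : G | x \in A} := fun u v => adj (val u) (val v).

Fact induced_sym : symmetric induced_adj.
Proof. by move=> u v; apply: adj_sym. Qed.
Fact induced_irrefl : irreflexive induced_adj.
Proof. by move=> u; apply: adj_irrefl. Qed.
Fact induced_gt0 : 0 < #|{: {x : G | x \in A}}|.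
Proof. by rewrite card_sig. Qed.

Definition induced : sgraph := SGraph induced_sym induced_irrefl induced_gt0.

Lemma good_induced : good_graph G -> good_graph induced.
Proof.
by move=> /good_graphP good; apply/good_graphP=> u v w; apply: good.
Qed.
End Induced.

(** Forgetting the side is injective because [A] and its complement are disjoint, hence bijective by
    counting. *)
Lemma graph_iso_join_induced (G : sgraph) (A : {set G})
    (A_gt0 : 0 < #|A|) (Ac_gt0 : 0 < #|~: A|) :
  {in A & ~: A, forall u v, adj u v} ->
  graph_iso G (graph_join (induced A_gt0) (induced Ac_gt0)).
Proof.
move=> full; apply: graph_iso_sym.
pose f (w : graph_join (induced A_gt0) (induced Ac_gt0)) : G :=
  match w with inl u => val u | inr v => val v end.
exists f.
  apply: inj_card_bij; last by rewrite card_sum !card_sig cardsC.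
  case=> [] [u uP] [] [v vP]; rewrite /f /= => uv.
  - by congr inl; apply: val_inj.
  - by exfalso; have := vP; rewrite -uv inE uP.
  - by exfalso; have := uP; rewrite uv inE vP.
  - by congr inr; apply: val_inj.
case=> u [] v //=; first exact: full (valP u) (valP v).
by rewrite adj_sym; apply: full (valP v) (valP u).
Qed.

(** Strong induction on the number of vertices, climbing by joins with edgeless graphs. The edge
    makes the neighbourhood of [x] nonempty; peeling stops once that neighbourhood is
    independent. *)
Lemma good_classHk (G : sgraph) (x y : G) :
  good_graph G -> adj x y -> exists k, classHk k.+1 G.
Proof.
have [n leGn] := ubnP #|G|.
elim: n => // n IHn in G leGn x y * => goodG xy.
have trans := (good_graphP G).1 goodG.
pose A := [set v | adj x v].
have xA : x \in ~: A by rewrite !inE adj_irrefl.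
have A_gt0 : 0 < #|A| by apply/card_gt0P; exists y; rewrite inE.
have Ac_gt0 : 0 < #|~: A| by apply/card_gt0P; exists x.
(* For [u] in [A] and [v] outside, the good edge from [x] to [u] makes [v] adjacent to [x] or [u],
   and [x] is excluded. *)
have /(graph_iso_join_induced A_gt0 Ac_gt0) isoG :
    {in A & ~: A, forall u v, adj u v}.
  by move=> u v; rewrite !inE => /(trans x u v)/orP[-> | ].
(* By goodness, an edge inside the complement would have an end adjacent to [x]. *)
have Ac_indep : forall u v : induced Ac_gt0, ~~ adj u v.
  move=> u v; apply/negP=> /(trans _ _ x); rewrite ![adj _ x]adj_sym.
  by have := valP u; have := valP v; rewrite !inE => /negPf-> /negPf->.
have isoAc := independent_iso_edgeless Ac_indep.
have [/existsP[u /existsP[v uv]] | A_indep] :=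
  boolP [exists u : induced A_gt0, exists v : induced A_gt0, adj u v].
  (* The complement of [A] is nonempty, so the neighbourhood is strictly smaller than [G]. *)
  have ltAn : #|induced A_gt0| < n.
    by rewrite card_sig -ltnS (leq_trans _ leGn) // ltnS -(cardsC A) -addn1 leq_add2l.
  have [k Hk] := IHn _ ltAn u v (good_induced (A_gt0 := A_gt0) goodG) uv.
  exists k.+1; right; exists (induced A_gt0), _, (vertex_gt0 (induced Ac_gt0)).
  split=> //; apply: graph_iso_trans isoG _.
  exact: graph_iso_join (graph_iso_refl _) isoAc.
have {}A_indep : forall u v : induced A_gt0, ~~ adj u v.
  by move=> u v; apply: contraNN A_indep => uv; apply/existsP; exists u;
     apply/existsP; exists v.
(* Both sides are independent, so [G] is complete bipartite and already in the first class. *)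
exists 0; right.
exists _, _, (vertex_gt0 (induced A_gt0)), (vertex_gt0 (induced Ac_gt0)).
apply: graph_iso_trans isoG _.
apply: graph_iso_trans (graph_iso_sym (complete_bipartite_iso_join _ _)).
exact: graph_iso_join (independent_iso_edgeless A_indep) isoAc.
Qed.

(** A path between distinct vertices would begin with an edge, so there is just one vertex. *)
Lemma connected_independent_iso_K1 (G : sgraph) :
  connected_graph G -> (forall u v : G, ~~ adj u v) -> graph_iso G K1.
Proof.
move=> conn indep; exists (fun _ => ord0); last first.
  by move=> u v; rewrite (negPf (indep u v)).
apply: inj_card_bij; last by rewrite card_ord vertex_gt0.
move=> u v _; have [[|w p] /= ] := connectP (conn u v); first by [].
by rewrite (negPf (indep u w)).
Qed.

Theorem theorem4 (G : sgraph) :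
  classH G <-> exists k : nat, 0 < k /\ classHk k G.
Proof.
split=> [[conn goodG] | [k [_ /classHk_classH]] //].
(* Peeling needs an edge to start from; a connected graph without edges is [K1]. *)
have [/existsP[x /existsP[y xy]] | indep] :=
  boolP [exists x : G, exists y : G, adj x y].
  by have [k Hk] := good_classHk goodG xy; exists k.+1.
exists 1; split=> //; left; apply: connected_independent_iso_K1 => // u v.
by apply: contraNN indep => uv; apply/existsP; exists u; apply/existsP; exists v.
Qed.
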